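(* Let $p$ be a prime and let $\nu\in\mathbb{Z}_p\llbracket(\mathbb{Z}/p)^{\mathbb{N}}\rrbracket$ be non-zero. Then there exists a finite set $M_\nu$ of continuous $\mathbb{C}_p^\times$-valued characters of $(\mathbb{Z}/p)^{\mathbb{N}}$ such that the following holds: for any continuous character $\chi:(\mathbb{Z}/p)^{\mathbb{N}}\to\mathbb{C}_p^\times$ there exists $\chi_0\in M_\nu$ such that $$v_p(\nu(\chi\chi_0))=\min_{\chi'}v_p(\nu(\chi')),$$ where the minimum is over all continuous characters $\chi':(\mathbb{Z}/p)^{\mathbb{N}}\to\mathbb{C}_p^\times$.
   Context: $\mathbb{N}=\mathbb{Z}_{>0}$; $(\mathbb{Z}/p)^{\mathbb{N}}=\prod_{n\in\mathbb{N}}\mathbb{Z}/p$ is given the product (profinite) topology, and $\mathbb{Z}_p\llbracket(\mathbb{Z}/p)^{\mathbb{N}}\rrbracket=\varprojlim_{n}\mathbb{Z}_p[(\mathbb{Z}/p)^n]$ with transition maps induced by projection onto the first factors. Its elements are identified with $\mathbb{Z}_p$-valued measures on $(\mathbb{Z}/p)^{\mathbb{N}}$ (horizontal measures). Every continuous character $\chi:(\mathbb{Z}/p)^{\mathbb{N}}\to\mathbb{C}_p^\times$ factors through some finite quotient $(\mathbb{Z}/p)^n$; if the image of $\nu$ in $\mathbb{Z}_p[(\mathbb{Z}/p)^n]$ is $\sum_x\nu_x[x]$, then $\nu(\chi):=\sum_x\nu_x\chi(x)\in\mathbb{C}_p$. $v_p:\mathbb{C}_p\to\mathbb{Q}\cup\{\infty\}$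 is the valuation normalized by $v_p(p)=1$. *)

(* Defs.v *)
From HB Require Import structures.
From mathcomp Require Import all_boot all_order all_algebra.
From mathcomp Require Import all_classical all_reals all_analysis.

Set Implicit Arguments.
Unset Strict Implicit.
Unset Printing Implicit Defensive.

Import Order.TTheory GRing.Theory Num.Theory.

Local Open Scope classical_set_scope.
Local Open Scope ring_scope.

(** * The ring of p-adic integers, as the inverse limit of the Z/p^(n+1) *)

(* Meant for m %| k with 1 < m: the projection Z/k -> Z/m. *)
Definition reduce_mod (m k : nat) (a : 'Z_k) : 'Z_m := (nat_of_ord a)%:R.

(* The levels start at n+1 because 'Z_(p ^ 0) is not the zero ring. *)
Record padic_int (p : nat) (p_pr : prime p) := PadicInt {
  residue :> forall n : nat, 'Z_(p ^ n.+1);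
  residueP : forall n, reduce_mod (p ^ n.+1) (residue n.+1) = residue n }.

Section ReduceMod.
Variables m k : nat.
Hypotheses (m_gt1 : (1 < m)%N) (k_gt1 : (1 < k)%N) (mk : (m %| k)%N).

Let natr_mod (a : nat) : (a %% k)%:R = a%:R :> 'Z_m.
Proof. by rewrite -(Zp_nat_mod m_gt1) modn_dvdm// Zp_nat_mod. Qed.

Lemma reduce_mod_nat (a : nat) : reduce_mod m (a%:R : 'Z_k) = a%:R.
Proof. by rewrite /reduce_mod val_Zp_nat. Qed.

Lemma reduce_modD (a b : 'Z_k) :
  reduce_mod m (a + b) = reduce_mod m a + reduce_mod m b.
Proof. by rewrite -[a]natr_Zp -[b]natr_Zp -natrD !reduce_mod_nat natrD. Qed.

Lemma reduce_modM (a b : 'Z_k) :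
  reduce_mod m (a * b) = reduce_mod m a * reduce_mod m b.
Proof. by rewrite -[a]natr_Zp -[b]natr_Zp -natrM !reduce_mod_nat natrM. Qed.

Lemma reduce_modN (a : 'Z_k) : reduce_mod m (- a) = - reduce_mod m a.
Proof.
by apply/eqP; rewrite -addr_eq0 -reduce_modD addNr -[0]/(0%:R) reduce_mod_nat.
Qed.

End ReduceMod.

Section PadicIntTheory.
Variables (p : nat) (p_pr : prime p).
Local Notation Zp := (padic_int p_pr).

Lemma padic_modulus_gt1 n : (1 < p ^ n.+1)%N.
Proof. by rewrite -[1%N](exp1n n.+1) ltn_exp2r// prime_gt1. Qed.

Let modD n := reduce_modD (padic_modulus_gt1 n) (padic_modulus_gt1 n.+1)
  (dvdn_exp2l p (leqnSn n.+1)).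
Let modM n := reduce_modM (padic_modulus_gt1 n) (padic_modulus_gt1 n.+1)
  (dvdn_exp2l p (leqnSn n.+1)).
Let modN n := reduce_modN (padic_modulus_gt1 n) (padic_modulus_gt1 n.+1)
  (dvdn_exp2l p (leqnSn n.+1)).
Let mod_nat n := reduce_mod_nat (padic_modulus_gt1 n) (padic_modulus_gt1 n.+1)
  (dvdn_exp2l p (leqnSn n.+1)).

Lemma padic_int_ext (x y : Zp) : (forall n, x n = y n) -> x = y.
Proof.
case: x y => [x xP] [y yP] /= xy.
have {}xy : x = y by apply: functional_extensionality_dep.
by subst y; congr PadicInt; exact: Prop_irrelevance.
Qed.

Fact padic_zeroP n : reduce_mod (p ^ n.+1) (0 : 'Z_(p ^ n.+2)) = 0.
Proof. by rewrite -[0]/(0%:R) mod_nat. Qed.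
Definition padic_zero : Zp := PadicInt p_pr padic_zeroP.

Fact padic_oneP n : reduce_mod (p ^ n.+1) (1 : 'Z_(p ^ n.+2)) = 1.
Proof. by rewrite -[1]/(1%:R) mod_nat. Qed.
Definition padic_one : Zp := PadicInt p_pr padic_oneP.

Fact padic_addP (x y : Zp) n :
  reduce_mod (p ^ n.+1) (x n.+1 + y n.+1) = x n + y n.
Proof. by rewrite modD !residueP. Qed.
Definition padic_add (x y : Zp) : Zp := PadicInt p_pr (padic_addP x y).

Fact padic_mulP (x y : Zp) n :
  reduce_mod (p ^ n.+1) (x n.+1 * y n.+1) = x n * y n.
Proof. by rewrite modM !residueP. Qed.
Definition padic_mul (x y : Zp) : Zp := PadicInt p_pr (padic_mulP x y).

Fact padic_oppP (x : Zp) n : reduce_mod (p ^ n.+1) (- x n.+1) = - x n.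
Proof. by rewrite modN residueP. Qed.
Definition padic_opp (x : Zp) : Zp := PadicInt p_pr (padic_oppP x).

HB.instance Definition _ := gen_eqMixin Zp.
HB.instance Definition _ := gen_choiceMixin Zp.

Fact padic_addA : associative padic_add.
Proof. by move=> x y z; apply: padic_int_ext => n /=; rewrite addrA. Qed.
Fact padic_addC : commutative padic_add.
Proof. by move=> x y; apply: padic_int_ext => n /=; rewrite addrC. Qed.
Fact padic_add0 : left_id padic_zero padic_add.
Proof. by move=> x; apply: padic_int_ext => n /=; rewrite add0r. Qed.
Fact padic_addN : left_inverse padic_zero padic_opp padic_add.
Proof. by move=> x; apply: padic_int_ext => n /=; rewrite addNr. Qed.

HB.instance Definition _ :=
  GRing.isZmodule.Build Zp padic_addA padic_addC padic_add0 padic_addN.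

Fact padic_mulA : associative padic_mul.
Proof. by move=> x y z; apply: padic_int_ext => n /=; rewrite mulrA. Qed.
Fact padic_mulC : commutative padic_mul.
Proof. by move=> x y; apply: padic_int_ext => n /=; rewrite mulrC. Qed.
Fact padic_mul1 : left_id padic_one padic_mul.
Proof. by move=> x; apply: padic_int_ext => n /=; rewrite mul1r. Qed.
Fact padic_mulDl : left_distributive padic_mul padic_add.
Proof. by move=> x y z; apply: padic_int_ext => n /=; rewrite mulrDl. Qed.
Fact padic_one_neq0 : padic_one != 0.
Proof.
by apply/eqP => /(congr1 (fun x : Zp => x 0%N)) /= /eqP; rewrite oner_eq0.
Qed.

HB.instance Definition _ := GRing.Zmodule_isComNzRing.Build Zp
  padic_mulA padic_mulC padic_mul1 padic_mulDl padic_one_neq0.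

Definition padic_unit : {pred Zp} := fun x => `[< exists y : Zp, y * x = 1 >].
Definition padic_inv (x : Zp) : Zp :=
  if pselect (exists y : Zp, y * x = 1) is left h then projT1 (cid h) else x.

Fact padic_mulVx : {in padic_unit, left_inverse 1 padic_inv *%R}.
Proof.
move=> x /asboolP hx; rewrite /padic_inv; case: pselect => // h.
exact: projT2 (cid h).
Qed.
Fact padic_unitP (x y : Zp) : y * x = 1 -> padic_unit x.
Proof. by move=> yx; apply/asboolP; exists y. Qed.
Fact padic_inv_out : {in [predC padic_unit], padic_inv =1 id}.
Proof.
by move=> x /asboolPn hx; rewrite /padic_inv; case: pselect.
Qed.

HB.instance Definition _ := GRing.ComNzRing_hasMulInverse.Build Zp
  padic_mulVx padic_unitP padic_inv_out.

Lemma padic_residue_mod (x : Zp) n i :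
  ((x (n + i)%N : nat)%:R : 'Z_(p ^ n.+1)) = x n.
Proof.
elim: i => [|i IHi]; first by rewrite addn0 natr_Zp.
rewrite -[RHS]IHi -(residueP x (n + i)) addnS /reduce_mod.
rewrite val_Zp_nat ?padic_modulus_gt1//.
rewrite -[RHS](Zp_nat_mod (padic_modulus_gt1 n)) modn_dvdm.
  by rewrite Zp_nat_mod ?padic_modulus_gt1.
by rewrite dvdn_exp2l// ltnS leq_addr.
Qed.

Lemma padic_residue_ndvd (x : Zp) n i :
  x n != 0 -> ~~ (p ^ n.+1 %| (x (n + i)%N : nat))%N.
Proof.
apply: contraNN => h; rewrite -(padic_residue_mod x n i).
by rewrite -(Zp_nat_mod (padic_modulus_gt1 n)) (eqP h).
Qed.

Fact padic_mul_eq0 (x y : Zp) : x * y = 0 -> (x == 0) || (y == 0).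
Proof.
move=> xy0; apply: contrapT => /negP; rewrite negb_or => /andP[/eqP x0 /eqP y0].
have nz (z : Zp) : z <> 0 -> exists n, z n != 0.
  move=> z0; apply: contrapT => h; apply: z0; apply: padic_int_ext => n.
  by apply/eqP; apply: contrapT => /negP hn; apply: h; exists n.
have [i xi] := nz _ x0; have [j yj] := nz _ y0.
have := padic_residue_ndvd j.+1 xi; have := padic_residue_ndvd i.+1 yj.
rewrite addnS (addnC j i) -addnS.
have := congr1 (fun z : Zp => z (i + j.+1)%N) xy0; rewrite /=.
set a := x _; set b := y _; move=> ab0 bN aN.
have : (p ^ (i + j.+1).+1 %| (a : nat) * (b : nat))%N.
  have : ((a * b)%N%:R : 'Z_(p ^ (i + j.+1).+1)) = 0.
    by rewrite natrM !natr_Zp.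
  move=> /(congr1 (@nat_of_ord _)) /eqP.
  by rewrite val_Zp_nat ?padic_modulus_gt1.
have gt0 (c k : nat) : ~~ (p ^ k %| c)%N -> (0 < c)%N.
  by case: c => //; rewrite dvdn0.
move: (gt0 _ _ aN) (gt0 _ _ bN) => a0 b0.
move: aN bN; rewrite !pfactor_dvdn ?muln_gt0 ?a0 ?b0// lognM// -!ltnNge !ltnS.
move=> ha hb; rewrite leqNgt => /negP; apply.
by rewrite ltnS leq_add// leqW.
Qed.

HB.instance Definition _ := GRing.ComUnitRing_isIntegral.Build Zp padic_mul_eq0.

End PadicIntTheory.

Definition padic_num (p : nat) (p_pr : prime p) := {fraction (padic_int p_pr)}.
HB.instance Definition _ p (p_pr : prime p) :=
  GRing.Field.on (padic_num p_pr).

(** * Completions of an algebraic closure of Q_p *)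

(* This determines C_p up to isomorphism: an algebraic closure of Q_p, embedded
   with dense image in a field that is complete for vp.  By vp_p and vp_int_ge0,
   vp restricts to the p-adic valuation of Q_p, which has only one extension to
   the algebraic closure and to its completion.  By vp_neqNy, vp takes its
   values in Q together with +oo. *)
Record complex_padics (p : nat) (p_pr : prime p) := ComplexPadics {
  padic_closure : closedFieldType;
  padic_num_embed : {rmorphism padic_num p_pr -> padic_closure};
  padic_closure_algebraic : forall x, algebraicOver padic_num_embed x;
  complex_padic :> fieldType;
  padic_closure_embed : {rmorphism padic_closure -> complex_padic};
  vp : complex_padic -> \bar rat;
  vp_neqNy : forall x, vp x <> -oo%E;
  vp_eqy : forall x, vp x = +oo%E <-> x = 0;
  vpM : forall x y, vp (x * y) = (vp x + vp y)%E;
  vp_ultra : forall x y, (Order.min (vp x) (vp y) <= vp (x + y))%E;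
  vp_p : vp p%:R = 1%:E;
  vp_int_ge0 : forall a : padic_int p_pr,
    (0 <= vp (padic_closure_embed (padic_num_embed (tofrac a))))%E;
  padic_closure_dense : forall (x : complex_padic) (r : rat),
    exists y, (r%:E < vp (x - padic_closure_embed y))%E;
  complex_padic_complete : forall u : nat -> complex_padic,
    (forall r : rat, exists N, forall m n, (N <= m)%N -> (N <= n)%N ->
      (r%:E < vp (u m - u n))%E) ->
    exists l, forall r : rat, exists N, forall n, (N <= n)%N ->
      (r%:E < vp (u n - l))%E }.

(** * The group (Z/p)^N, its measures and its characters *)

(* The coordinates are numbered from 0. *)
Definition horiz_group (p : nat) : Type :=
  prod_topology (fun _ : nat => discrete_topology 'Z_p).
HB.instance Definition _ p := Topological.on (horiz_group p).
HB.instance Definition _ p :=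
  GRing.Zmodule.copy (horiz_group p) (nat -> 'Z_p).

Definition trunc p n (x : horiz_group p) : {ffun 'I_n -> 'Z_p} :=
  [ffun i : 'I_n => x i].

Definition forget_last p n (x : {ffun 'I_n.+1 -> 'Z_p}) : {ffun 'I_n -> 'Z_p} :=
  [ffun i => x (widen_ord (leqnSn n) i)].

(* The element \sum_x mu x * [x] of R[(Z/p)^n] is given by its coefficients mu,
   and maps to \sum_x mu x * [forget_last x]. *)
Definition pushforward (R : nmodType) p n
    (mu : {ffun {ffun 'I_n.+1 -> 'Z_p} -> R}) :
    {ffun {ffun 'I_n -> 'Z_p} -> R} :=
  [ffun y => \sum_(x | forget_last x == y) mu x].

Record horiz_measure p (p_pr : prime p) := HorizMeasure {
  level :> forall n, {ffun {ffun 'I_n -> 'Z_p} -> padic_int p_pr};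
  levelP : forall n, pushforward (level n.+1) = level n }.

(* Continuity for the topology of C given by vp. *)
Definition vp_continuous p (p_pr : prime p) (C : complex_padics p_pr)
    (f : horiz_group p -> C) :=
  forall (x : horiz_group p) (r : rat),
    \forall y \near x, (r%:E < vp (f y - f x))%E.

Record character p (p_pr : prime p) (C : complex_padics p_pr) := Character {
  char_fun :> horiz_group p -> C;
  char_neq0 : forall x, char_fun x != 0;
  char_morph : forall x y, char_fun (x + y) = char_fun x * char_fun y;
  char_continuous : vp_continuous char_fun }.

Section ComplexPadicsTheory.
Variables (p : nat) (p_pr : prime p) (C : complex_padics p_pr).
Implicit Types (x y : C) (chi : character C) (nu : horiz_measure p_pr).

Lemma vp1 : vp (1 : C) = 0%E.
Proof.
have := vpM (1 : C) 1; rewrite mulr1.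
case E : (vp (1 : C)) => [a| |] //=.
- by case=> /eqP; rewrite -subr_eq0 opprD addNKr oppr_eq0 => /eqP ->.
- by move/vp_eqy: E => /eqP; rewrite oner_eq0.
- by move: E => /vp_neqNy.
Qed.

Lemma vp_fin x : x != 0 -> exists r, vp x = r%:E.
Proof.
move=> x0; case E : (vp x) => [r| |]; first by exists r.
  by move/vp_eqy: E x0 => ->; rewrite eqxx.
by move: E => /vp_neqNy.
Qed.

Lemma vp_root1 n x : x ^+ n.+1 = 1 -> vp x = 0%E.
Proof.
move=> xn; have x0 : x != 0.
  by apply/eqP => x0; move/eqP: xn; rewrite x0 expr0n eq_sym oner_eq0.
have [r xr] := vp_fin x0.
have vX k : vp (x ^+ k) = (r *+ k)%:E.
  by elim: k => [|k IHk]; rewrite ?expr0 ?vp1// exprS vpM IHk xr mulrS.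
move: (vX n.+1); rewrite xn vp1 => -[] /esym/eqP.
by rewrite mulrn_eq0 /= => /eqP r0; rewrite xr r0.
Qed.

Lemma vpN x : vp (- x) = vp x.
Proof.
rewrite -mulN1r vpM (_ : vp (-1) = 0%E) ?add0e//.
by apply: (@vp_root1 1); rewrite sqrrN expr1n.
Qed.

Lemma vpD_gt (r : rat) x y :
  (r%:E < vp x)%E -> (r%:E < vp y)%E -> (r%:E < vp (x + y))%E.
Proof.
by move=> rx ry; apply: lt_le_trans (vp_ultra x y); rewrite lt_min rx.
Qed.

Lemma horiz_group_torsion (a : horiz_group p) : a *+ p = 0.
Proof.
apply/funext => i; have natE n : (a *+ n) i = a i *+ n.
  by elim: n => [//|n IHn]; rewrite mulrS [RHS]mulrS -IHn.
rewrite natE.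
rewrite -[a i]natr_Zp -mulrnA -Zp_nat_mod ?prime_gt1//.
by rewrite modnMl.
Qed.

Lemma char0 chi : chi 0 = 1.
Proof.
apply: (mulfI (char_neq0 chi 0)).
by rewrite -char_morph addr0 mulr1.
Qed.

Lemma char_root1 chi a : chi a ^+ p = 1.
Proof.
have charX k : chi (a *+ k) = chi a ^+ k.
  by elim: k => [|k IHk]; rewrite ?mulr0n ?char0// mulrS char_morph IHk exprS.
by rewrite -charX horiz_group_torsion char0.
Qed.

Lemma vp_char chi a : vp (chi a) = 0%E.
Proof.
by apply: (@vp_root1 p.-1); rewrite prednK ?prime_gt0// char_root1.
Qed.

Fact char_mul_neq0 chi1 chi2 a : chi1 a * chi2 a != 0.
Proof. by rewrite mulf_neq0 ?char_neq0. Qed.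

Fact char_mul_morph chi1 chi2 a b :
  chi1 (a + b) * chi2 (a + b) = (chi1 a * chi2 a) * (chi1 b * chi2 b).
Proof. by rewrite !char_morph mulrACA. Qed.

Fact char_mul_continuous chi1 chi2 :
  vp_continuous (fun a => chi1 a * chi2 a).
Proof.
move=> a r; near=> b.
have h1 : (r%:E < vp (chi1 b - chi1 a))%E.
  by near: b; exact: char_continuous.
have h2 : (r%:E < vp (chi2 b - chi2 a))%E.
  by near: b; exact: char_continuous.
rewrite (_ : _ - _ = chi1 b * (chi2 b - chi2 a) + (chi1 b - chi1 a) * chi2 a).
  by apply: vpD_gt; rewrite vpM vp_char ?add0e ?adde0.
by rewrite mulrBr mulrBl addrA subrK.
Unshelve. all: by end_near. Qed.

Definition char_mul chi1 chi2 : character C :=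
  Character (char_mul_neq0 chi1 chi2) (char_mul_morph chi1 chi2)
    (char_mul_continuous chi1 chi2).

Definition factors_through n chi (phi : {ffun 'I_n -> 'Z_p} -> C) :=
  forall a, chi a = phi (trunc n a).

Definition padic_int_embed (a : padic_int p_pr) : C :=
  padic_closure_embed C (padic_num_embed C (tofrac a)).

Definition level_eval nu n (phi : {ffun 'I_n -> 'Z_p} -> C) : C :=
  \sum_x padic_int_embed (nu n x) * phi x.

Definition char_eval nu chi : C :=
  xget 0 [set z | exists n (phi : {ffun 'I_n -> 'Z_p} -> C),
    factors_through chi phi /\ z = level_eval nu phi].

(* The following lemmas show that the default value 0 of char_eval is never
   used, and that the level and the factorization are irrelevant. *)

Lemma trunc_surj n (x : {ffun 'I_n -> 'Z_p}) : exists a, trunc n a = x.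
Proof.
exists (fun i => if insub i is Some j then x j else 0).
by apply/ffunP => i; rewrite ffunE valK.
Qed.

Lemma trunc_forget n (a : horiz_group p) :
  forget_last (trunc n.+1 a) = trunc n a.
Proof. by apply/ffunP => i; rewrite !ffunE. Qed.

Lemma padic_int_embed_sum I (s : seq I) P (F : I -> padic_int p_pr) :
  padic_int_embed (\sum_(i <- s | P i) F i)
  = \sum_(i <- s | P i) padic_int_embed (F i).
Proof. by rewrite /padic_int_embed !rmorph_sum. Qed.

Lemma level_evalS nu n (phi : {ffun 'I_n -> 'Z_p} -> C) :
  level_eval nu (fun x : {ffun 'I_n.+1 -> 'Z_p} => phi (forget_last x))
  = level_eval nu phi.
Proof.
rewrite /level_eval (partition_big (@forget_last p n) xpredT)//=.
apply: eq_bigr => y _; rewrite -(levelP nu n) ffunE padic_int_embed_sum.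
by rewrite mulr_suml; apply: eq_bigr => x /eqP ->.
Qed.

Lemma level_eval_unique nu chi n m (phi : {ffun 'I_n -> 'Z_p} -> C)
    (psi : {ffun 'I_m -> 'Z_p} -> C) :
  factors_through chi phi -> factors_through chi psi ->
  level_eval nu phi = level_eval nu psi.
Proof.
have eq_level k (f g : {ffun 'I_k -> 'Z_p} -> C) :
    factors_through chi f -> factors_through chi g ->
    level_eval nu f = level_eval nu g.
  move=> chif chig; apply: eq_bigr => x _.
  by have [a <-] := trunc_surj x; rewrite -chif -chig.
have lift k i (f : {ffun 'I_k -> 'Z_p} -> C) : factors_through chi f ->
    exists2 g : {ffun 'I_(i + k) -> 'Z_p} -> C,
      factors_through chi g & level_eval nu f = level_eval nu g.
  elim: i => [|i IHi] chif; first by exists f.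
  have [g chig ->] := IHi chif.
  exists (fun z : {ffun 'I_(i + k).+1 -> 'Z_p} => g (forget_last z)).
    by move=> a; rewrite trunc_forget.
  by rewrite level_evalS.
move=> /(lift _ m)[f chif ->] /(lift _ n)[g chig ->].
move: f chif; rewrite addnC => f chif; exact: eq_level.
Qed.

Lemma char_evalE nu chi n (phi : {ffun 'I_n -> 'Z_p} -> C) :
  factors_through chi phi -> char_eval nu chi = level_eval nu phi.
Proof.
move=> chiphi; rewrite /char_eval; case: xgetP => [z _ [m [psi [chipsi ->]]]|].
  exact: level_eval_unique chipsi chiphi.
by move=> /(_ (level_eval nu phi)) []; exists n, phi.
Qed.

Lemma horiz_group_cvg (a : horiz_group p) (b : nat -> horiz_group p) :
  (forall i, \forall n \near \oo, b n i = a i) -> b @ \oo --> a.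
Proof.
move=> ba; apply/cvg_sup => i A [_ [[B _ <-] /= Ba BA]].
by apply: filterS (ba i) => n bai; apply: BA; rewrite /= bai.
Qed.

Lemma root1_eq1 x : x ^+ p = 1 -> (1%:E < vp (x - 1))%E -> x = 1.
Proof.
move=> xp x1; apply: contrapT => /eqP x_neq1.
have : (1%:E < vp (p%:R : C))%E; last by rewrite vp_p ltxx.
have xX k : (1%:E < vp (x ^+ k - 1))%E.
  elim: k => [|k IHk]; first by rewrite expr0 subrr (vp_eqy (0 : C)).2// ltry.
  rewrite (_ : _ - 1 = x * (x ^+ k - 1) + (x - 1)).
    apply: vpD_gt => //; rewrite vpM (@vp_root1 p.-1) ?add0e//.
    by rewrite prednK ?prime_gt0.
  by rewrite exprS mulrBr mulr1 addrA subrK.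
have : \sum_(i < p) x ^+ i = 0.
  apply: (mulfI (x := x - 1)); first by rewrite subr_eq0.
  by rewrite -subrX1 xp subrr mulr0.
move=> sum0; rewrite -vpN -[- _]add0r -sum0.
have -> : p%:R = \sum_(i < p) 1 :> C by rewrite sumr_const card_ord.
rewrite -sumrB; elim/big_ind: _ => [|y z|i _]; last exact: xX.
  by rewrite (vp_eqy (0 : C)).2// ltry.
exact: vpD_gt.
Qed.

Lemma char_factors chi :
  exists n (phi : {ffun 'I_n -> 'Z_p} -> C), factors_through chi phi.
Proof.
have [n chi1] : exists n, forall a : horiz_group p,
    (forall i, (i < n)%N -> a i = 0) -> chi a = 1.
  apply: contrapT => /forallNP noN.
  have /choice[b bP] : forall n, exists a : horiz_group p,
      (forall i, (i < n)%N -> a i = 0) /\ chi a <> 1.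
    move=> n; have /existsNP[a /not_implyP[]] := noN n.
    by exists a.
  have b0 : b @ \oo --> (0 : horiz_group p).
    apply: horiz_group_cvg => i; near=> n.
    by apply: (bP n).1; near: n; exact: nbhs_infty_gt.
  have [N _ /(_ N (leqnn N))] := b0 _ (@char_continuous _ _ _ chi 0 1).
  rewrite /= char0 => h; apply: (bP N).2.
  by apply: root1_eq1 h; exact: char_root1.
have [g gK] : exists g, forall x : {ffun 'I_n -> 'Z_p}, trunc n (g x) = x.
  by have /choice[g gP] := @trunc_surj n; exists g.
exists n, (fun z => chi (g z)) => a.
rewrite -[in LHS](subrK (g (trunc n a)) a) char_morph chi1 ?mul1r// => i i_n.
have /ffunP/(_ (Ordinal i_n)) := gK (trunc n a).
rewrite !ffunE /= => gi.
have -> : (a - g (trunc n a)) i = a i - g (trunc n a) i.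
  by [].
by rewrite gi subrr.
Unshelve. all: by end_near. Qed.

End ComplexPadicsTheory.

Definition is_minimum d (T : porderType d) (A : set T) (m : T) :=
  A m /\ lbound A m.

(* Main.v *)
(* Let z be a primitive p-th root of unity and pi = z - 1.  The values nu(chi)
   lie in Z_p[z], whose nonzero elements have valuation in N * vp pi, so the
   minimal valuation m is attained.  The iterated difference of nu(chi) in
   directions h_1, ..., h_d is the integral of chi * \prod_i (h_i - 1), so its
   valuation is at least d * vp pi.  Take d maximal such that some difference of
   order d has valuation at most m, and let h_1, ..., h_d be its directions:
   modulo elements of valuation greater than m, this difference does not depend
   on chi, so it has valuation at most m for every chi.  It is a signed sum of
   the values nu(chi * \prod_(i in S) h_i), so the products of subfamilies of
   h_1, ..., h_d form the required set. *)
From HB Require Import structures.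
Require Import Defs.
From mathcomp Require Import all_boot all_order all_algebra.
From mathcomp Require Import all_classical all_reals all_analysis.

Set Implicit Arguments.
Unset Strict Implicit.
Unset Printing Implicit Defensive.

Import Order.TTheory GRing.Theory Num.Theory.

Local Open Scope classical_set_scope.
Local Open Scope ring_scope.

(** Splits off the first p-adic digit [r], which is either 0 or prime to p; [ev_div] rests on this
    dichotomy. *)
Lemma padic_int_decomp (p : nat) (p_pr : prime p) (a : padic_int p_pr) :
  exists2 r : nat, (r < p)%N
    & exists b : padic_int p_pr, a = r%:R + p%:R * b.
Proof.
have p_gt0 := prime_gt0 p_pr; have gt1 := padic_modulus_gt1 p_pr.
have lt_a n : (a n < p ^ n.+1)%N.
  by rewrite -[X in (_ < X)%N](Zp_cast (gt1 n)) ltn_ord.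
have aS n : (a n.+1 %% p ^ n.+1)%N = a n.
  rewrite -[in RHS](residueP a n) /reduce_mod.
  by rewrite val_Zp_nat ?gt1.
have natE (x : padic_int p_pr) n : ((x n : nat)%:R : 'Z_(p ^ n.+1)) = x n.
  exact: natr_Zp.
(* Division by p loses one digit, so level n of the quotient is read off level [n.+1] of [a]. *)
pose b n : 'Z_(p ^ n.+1) := (a n.+1 %/ p)%N%:R.
have bP n : reduce_mod (p ^ n.+1) (b n.+1) = b n.
  rewrite /b reduce_mod_nat ?gt1 ?dvdn_exp2l //-[LHS](Zp_nat_mod (gt1 n)).
  by rewrite modn_divl -expnSr aS.
have levelE n (m : nat) : (m%:R : padic_int p_pr) n = m%:R.
  by elim: m => // m IHm; rewrite -natr1 -[RHS]natr1 -IHm.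
exists (a 0%N); first by rewrite -[X in (_ < X)%N]expn1.
exists (PadicInt p_pr bP); apply: padic_int_ext => n.
transitivity (((a 0%N : nat)%:R + p%:R * b n) : 'Z_(p ^ n.+1)); last first.
  by rewrite -!levelE.
have a0 m : (a m %% p)%N = a 0%N.
  elim: m => [|m IHm]; first by rewrite modn_small // -[X in (_ < X)%N]expn1.
  by rewrite -IHm -(aS m) modn_dvdm // dvdn_exp.
rewrite /b -natrM -natrD -(a0 n.+1) addnC mulnC -divn_eq.
by rewrite -[RHS](Zp_nat_mod (gt1 n)) aS natE.
Qed.

HB.instance Definition _ p (p_pr : prime p) (C : complex_padics p_pr) :=
  GRing.RMorphism.copy (@padic_int_embed p p_pr C)
    (padic_closure_embed C \o padic_num_embed C \o @tofrac (padic_int p_pr)).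

(** * Valuation of natural numbers and p-th roots of unity *)

Section Valuation.
Variables (p : nat) (p_pr : prime p) (C : complex_padics p_pr).
Implicit Types (x y : C) (r : \bar rat).

Lemma vpD_ge r x y :
  (r <= vp x)%E -> (r <= vp y)%E -> (r <= vp (x + y))%E.
Proof.
by move=> rx ry; apply: le_trans (vp_ultra x y); rewrite le_min rx.
Qed.

Lemma vp_sum_ge r I (s : seq I) (P : pred I) (F : I -> C) :
  (forall i, P i -> (r <= vp (F i))%E) ->
  (r <= vp (\sum_(i <- s | P i) F i))%E.
Proof.
move=> rF; apply: (@big_ind C (fun x => (r <= vp x)%E)) => //.
  by rewrite (vp_eqy (0 : C)).2 ?leey.
by move=> x y; exact: vpD_ge.
Qed.

Lemma vpM_ge0 x y : (0 <= vp x)%E -> (0 <= vp y)%E -> (0 <= vp (x * y))%E.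
Proof. by move=> x0 y0; rewrite vpM adde_ge0. Qed.

Lemma vp_nat_ge0 n : (0 <= vp (n%:R : C))%E.
Proof.
rewrite -[n%:R](rmorph_nat (@padic_int_embed p p_pr C)); exact: vp_int_ge0.
Qed.

Lemma vpX_eq0 x n : vp x = 0%E -> vp (x ^+ n) = 0%E.
Proof.
by move=> x0; elim: n => [|n IHn]; rewrite ?expr0 ?vp1 // exprS vpM x0 add0e.
Qed.

Lemma vpX_ge0 x n : (0 <= vp x)%E -> (0 <= vp (x ^+ n))%E.
Proof.
by move=> x0; elim: n => [|n IHn]; rewrite ?expr0 ?vp1 // exprS vpM_ge0.
Qed.

Lemma vpD_eq0 x y : vp x = 0%E -> (0 < vp y)%E -> vp (x + y) = 0%E.
Proof.
move=> x0 y0; have : (0 <= vp (x + y))%E by rewrite vpD_ge ?x0 // ltW.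
rewrite le_eqVlt => /predU1P[//|xy0].
have : ((0 : rat)%:E < vp (x + y - y))%E by apply: vpD_gt; rewrite ?vpN.
by rewrite addrK x0 ltxx.
Qed.

(** Bezout gives u * n = k * p + 1, of valuation 0, while u and n both have nonnegative
    valuation. *)
Lemma vp_nat_unit n : (0 < n < p)%N -> vp (n%:R : C) = 0%E.
Proof.
move=> /andP[n0 np].
have cop : coprime n p.
  by rewrite coprime_sym prime_coprime // gtnNdvd.
case: (egcdnP p n0) => u k; rewrite (eqnP cop) => e _.
apply/eqP; rewrite eq_le vp_nat_ge0 andbT.
have : vp ((u * n)%N%:R : C) = 0%E.
  rewrite e natrD addrC vpD_eq0 ?vp1 // natrM vpM vp_p.
  by rewrite (lt_le_trans (_ : (0 < 1%:E)%E)) ?lte_fin // leeDr ?vp_nat_ge0.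
by rewrite natrM vpM => <-; rewrite leeDr ?vp_nat_ge0.
Qed.

(** If y = x - 1 had valuation 0, so would y^p; but expanding (y + 1)^p = 1 writes y^p as minus a
    sum of middle binomial terms, each divisible by p. *)
Lemma root1_sub1_gt0 x : x ^+ p = 1 -> (0 < vp (x - 1))%E.
Proof.
move=> xp; set y := x - 1.
have vx : vp x = 0%E.
  by apply: (@vp_root1 _ _ _ p.-1); rewrite prednK ?prime_gt0.
have y0 : (0 <= vp y)%E by rewrite vpD_ge ?vpN ?vx ?vp1.
rewrite lt_neqAle y0 andbT; apply/eqP => /esym vy.
suff : (1%:E <= vp (y ^+ p))%E.
  by rewrite vpX_eq0 // lee_fin ler10.
have : (y + 1) ^+ p = 1 by rewrite subrK.
rewrite exprDn -(big_mkord xpredT (fun i => y ^+ (p - i) * 1 ^+ i *+ 'C(p, i))).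
rewrite big_ltn // big_nat_recr ?prime_gt0 //= subn0 subnn !expr0 !expr1n.
rewrite bin0 binn !mulr1n !mulr1 addrA => /(canRL (addrK _)).
rewrite subrr => /(canRL (addrK _)); rewrite add0r => ->; rewrite vpN big_nat.
apply: vp_sum_ge => i i_p; have /dvdnP[k ->] := prime_dvd_bin p_pr i_p.
rewrite expr1n mulr1 -mulr_natr natrM !vpM vp_p addeA leeDr // adde_ge0 //.
  exact: vpX_ge0.
exact: vp_nat_ge0.
Qed.

(** Take a root of 1 + X + ... + X^(p-1) in the algebraic closure. Its image is not 1 because p is
    nonzero in [C]; its order divides the prime p, so it generates all p-th roots of unity. *)
Lemma root1_exists :
  exists z : C, [/\ z ^+ p = 1, z != 1
    & forall x, x ^+ p = 1 -> exists i, x = z ^+ i].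
Proof.
have [w w0] : exists w : padic_closure C, root (\sum_(i < p) 'X^i) w.
  apply/closed_rootP; rewrite -(big_mkord xpredT (fun i => 'X^i)).
  have -> : \sum_(0 <= i < p) 'X^i = \poly_(i < p) 1 :> {poly padic_closure C}.
    by rewrite poly_def big_mkord; apply: eq_bigr => i _; rewrite scale1r.
  by rewrite size_poly_eq ?oner_eq0 // neq_ltn prime_gt1 // orbT.
have wp : w ^+ p = 1.
  apply/eqP; rewrite -subr_eq0 subrX1 mulf_eq0; apply/orP; right.
  by move: w0; rewrite /root horner_sum; under eq_bigr do rewrite hornerXn.
set z := padic_closure_embed C w.
have zp : z ^+ p = 1 by rewrite -rmorphXn wp rmorph1.
have z1 : z != 1.
  apply/eqP => z1; move: w0; rewrite /root horner_sum.
  under eq_bigr do rewrite hornerXn.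
  move=> /eqP /(congr1 (padic_closure_embed C)); rewrite rmorph0 rmorph_sum /=.
  under eq_bigr do rewrite rmorphXn -/z z1 expr1n.
  rewrite sumr_const card_ord => p0; have := vp_p C.
  by rewrite (vp_eqy (p%:R : C)).2.
exists z; split=> // x xp.
have [m zm m_p] := prim_order_exists (prime_gt0 p_pr) zp.
have xm : x ^+ m = 1.
  case/primeP: (p_pr) => _ /(_ m m_p)/orP[/eqP m1|/eqP -> //].
  by move: (prim_expr_order zm) z1; rewrite m1 expr1 => ->; rewrite eqxx.
by have [i ->] := prim_rootP zm xm; exists i.
Qed.

(** * Discreteness of the valuation on Z_p[z] *)

Section CyclotomicIntegers.
Variable z : C.
Hypotheses (zp : z ^+ p = 1) (z_neq1 : z != 1).
Let emb := @padic_int_embed p p_pr C.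
(** The image is Z_p[z]. Evaluating at z - 1 instead of z makes a value congruent to its constant
    coefficient modulo z - 1. *)
Let ev : {rmorphism {poly padic_int p_pr} -> C} :=
  horner_eval (z - 1) \o map_poly emb.

Let evX : ev 'X = z - 1.
Proof. by rewrite /= map_polyX horner_evalE hornerX. Qed.

Let evC a : ev a%:P = emb a.
Proof. by rewrite /= map_polyC horner_evalE hornerC. Qed.

Let ev_root i : ev (('X + 1) ^+ i) = z ^+ i.
Proof. by rewrite rmorphXn rmorphD rmorph1 evX subrK. Qed.

Let emb_decomp (r : nat) b : emb (r%:R + p%:R * b) = r%:R + p%:R * emb b.
Proof. by rewrite /emb rmorphD rmorphM !rmorph_nat. Qed.

Let ev_ge0 q : (0 <= vp (ev q))%E.
Proof.
elim/poly_ind: q => [|q a IHq].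
  by rewrite rmorph0 (vp_eqy (0 : C)).2 ?leey.
rewrite rmorphD rmorphM evX evC vpD_ge ?vp_int_ge0 // vpM_ge0 //.
exact/ltW/root1_sub1_gt0.
Qed.

(** The powers of z sum to 0, so p is the sum of the 1 - z^i for i < p, each divisible by z - 1. *)
Let ev_p : exists t, p%:R = (z - 1) * ev t.
Proof.
exists (- \sum_(i < p) \sum_(j < i) ('X + 1) ^+ j).
have z0 : \sum_(i < p) z ^+ i = 0.
  by apply: (mulfI (x := z - 1)); rewrite ?subr_eq0 // -subrX1 zp subrr mulr0.
rewrite rmorphN mulrN rmorph_sum mulr_sumr -sumrN.
transitivity (\sum_(i < p) (1 - z ^+ i)).
  by rewrite sumrB z0 subr0 sumr_const card_ord.
apply: eq_bigr => i _; rewrite rmorph_sum.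
by under eq_bigr do rewrite ev_root; rewrite -subrX1 opprB.
Qed.

(** Since z - 1 divides p, only the first digit of the constant coefficient survives modulo z - 1,
    and a nonzero digit has valuation 0. *)
Let ev_div q : vp (ev q) = 0%E \/ exists q', ev q = (z - 1) * ev q'.
Proof.
elim/poly_ind: q => [|q a _].
  by right; exists 0; rewrite rmorph0 mulr0.
have [[|r] r_p [b ->]] := padic_int_decomp a; have [t pt] := ev_p.
  right; exists (q + t * b%:P).
  rewrite rmorphD rmorphM evX evC emb_decomp rmorphD rmorphM evC.
  by rewrite add0r pt [RHS]mulrDr mulrA [ev q * _]mulrC.
left; rewrite rmorphD rmorphM evX evC emb_decomp addrCA.
rewrite vpD_eq0 ?vp_nat_unit // pt -mulrA -evC -rmorphM [ev q * _]mulrC -mulrDr.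
by rewrite vpM -rmorphD (lt_le_trans (root1_sub1_gt0 zp)) // leeDl.
Qed.

Let ev_vp (c : rat) q : vp (z - 1) = c%:E -> ev q != 0 ->
  exists k : nat, vp (ev q) = (k%:R * c)%:E.
Proof.
move=> zc q0; have [r qr] := vp_fin q0.
have c0 : 0 < c by have := root1_sub1_gt0 zp; rewrite zc lte_fin.
have r0 : 0 <= r by have := ev_ge0 q; rewrite qr lee_fin.
(* Divide by z - 1 up to N times: either a quotient of valuation 0 turns up, or the valuation is at
   least N * c. The latter fails once N exceeds r / c. *)
have dicho N : forall q, ((N%:R * c)%:E <= vp (ev q))%E \/
    exists k : nat, vp (ev q) = (k%:R * c)%:E.
  elim: N => [|N IHN] q1; first by left; rewrite mul0r.
  have [->|[q2 ->]] := ev_div q1; first by right; exists 0%N; rewrite mul0r.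
  have [h|[k h]] := IHN q2; [left|right; exists k.+1].
    by rewrite vpM zc -[N.+1]add1n natrD mulrDl mul1r EFinD leeD2l.
  by rewrite vpM zc h -[k.+1]add1n natrD mulrDl mul1r EFinD.
have [|//] := dicho (Num.Def.archi_bound (r / c)) q.
rewrite qr lee_fin -ler_pdivlMr // leNgt archi_boundP //.
by rewrite divr_ge0 // ltW.
Qed.

Lemma vp_cyclotomic_integer (c : rat) (I : finType) (a : I -> padic_int p_pr)
    (e : I -> nat) (x := \sum_i padic_int_embed C (a i) * z ^+ e i) :
  vp (z - 1) = c%:E -> x != 0 -> exists k : nat, vp x = (k%:R * c)%:E.
Proof.
suff -> : x = ev (\sum_i (a i)%:P * ('X + 1) ^+ e i) by exact: ev_vp.
by rewrite rmorph_sum; apply: eq_bigr => i _; rewrite rmorphM evC ev_root.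
Qed.

End CyclotomicIntegers.
End Valuation.

(** * The group of characters *)

Section Characters.
Variables (p : nat) (p_pr : prime p) (C : complex_padics p_pr).
Implicit Types (chi h : character C) (nu : horiz_measure p_pr).

Lemma character_ext chi1 chi2 : (forall a, chi1 a = chi2 a) -> chi1 = chi2.
Proof.
case: chi1 chi2 => [f f0 fM fc] [g g0 gM gc] /= /funext fg.
by subst g; congr Character; exact: Prop_irrelevance.
Qed.

Lemma char_mulA : associative (@char_mul p p_pr C).
Proof. by move=> *; apply: character_ext => a /=; rewrite mulrA. Qed.

Fact char_one_neq0 (a : horiz_group p) : (1 : C) != 0.
Proof. exact: oner_neq0. Qed.

Fact char_one_morph (a b : horiz_group p) : (1 : C) = 1 * 1.
Proof. by rewrite mulr1. Qed.

Fact char_one_continuous : vp_continuous (fun _ : horiz_group p => 1 : C).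
Proof.
move=> a r; near=> b; rewrite subrr (vp_eqy (0 : C)).2 ?ltry //.
Unshelve. all: by end_near. Qed.

Definition char_one : character C :=
  Character char_one_neq0 char_one_morph char_one_continuous.

Lemma char_mul1 chi : char_mul chi char_one = chi.
Proof. by apply: character_ext => a /=; rewrite mulr1. Qed.

Lemma char_div_exists chi1 chi2 : exists h, char_mul chi1 h = chi2.
Proof.
(* As chi1^p = 1, the inverse of [chi1] is its power p - 1. *)
pose h := iter p.-1 (char_mul chi1) chi2.
have hE n a : iter n (char_mul chi1) chi2 a = chi1 a ^+ n * chi2 a.
  by elim: n => [|n IHn]; rewrite ?mul1r //= IHn exprS mulrA.
exists h; apply: character_ext => a; rewrite /h -[LHS]/(_ * _).
by rewrite hE mulrA -exprS prednK ?prime_gt0 // char_root1 mul1r.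
Qed.

(** Unlike [factors_through], this names no function on the quotient, so it passes directly to
    higher levels and to products. *)
Definition factors_at n chi :=
  forall a b : horiz_group p, trunc n a = trunc n b -> chi a = chi b.

Lemma factors_at_exists chi : exists n, factors_at n chi.
Proof.
have [n [phi chiE]] := char_factors chi.
by exists n => a b ab; rewrite !chiE ab.
Qed.

Lemma factors_at_le m n chi :
  (m <= n)%N -> factors_at m chi -> factors_at n chi.
Proof.
move=> mn chim a b /ffunP ab; apply: chim; apply/ffunP => i.
by have := ab (widen_ord mn i); rewrite !ffunE.
Qed.

Lemma factors_atM n chi1 chi2 :
  factors_at n chi1 -> factors_at n chi2 -> factors_at n (char_mul chi1 chi2).
Proof. by move=> f1 f2 a b ab; rewrite /= (f1 a b) ?(f2 a b). Qed.

Definition extend0 n (x : {ffun 'I_n -> 'Z_p}) : horiz_group p :=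
  fun i => if insub i is Some j then x j else 0.

Lemma extend0K n : cancel (@extend0 n) (@trunc p n).
Proof. by move=> x; apply/ffunP => i; rewrite ffunE /extend0 valK. Qed.

Lemma char_eval_level nu n chi : factors_at n chi ->
  char_eval nu chi = \sum_x padic_int_embed C (nu n x) * chi (extend0 x).
Proof.
move=> chin; apply: (char_evalE nu (phi := fun x => chi (extend0 x))) => a.
by apply: chin; rewrite extend0K.
Qed.

(** * Iterated differences *)

Fixpoint char_diff nu (hs : seq (character C)) chi : C :=
  if hs is h :: hs' then
    char_diff nu hs' (char_mul chi h) - char_diff nu hs' chi
  else char_eval nu chi.

(** Each difference multiplies the integrand by h - 1. The bound [n] depends on [hs] alone, so that
    the induction hypothesis applies to [chi] and [char_mul chi h] at one level. *)
Lemma char_diffE nu hs : exists n, forall m chi, (n <= m)%N ->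
  factors_at m chi ->
  char_diff nu hs chi = \sum_x padic_int_embed C (nu m x) *
    (chi (extend0 x) * \prod_(h <- hs) (h (extend0 x) - 1)).
Proof.
elim: hs => [|h hs [n IHn]].
  exists 0%N => m chi _ chim; rewrite [LHS](char_eval_level _ chim).
  by apply: eq_bigr => x _; rewrite big_nil mulr1.
have [k hk] := factors_at_exists h; exists (maxn n k) => m chi.
rewrite geq_max => /andP[nm km] chim /=.
have hm := factors_at_le km hk.
rewrite !(IHn m) //; last exact: factors_atM.
rewrite -sumrB; apply: eq_bigr => x _; rewrite -mulrBr big_cons /=.
by congr (_ * _); rewrite -mulrBl mulrA [in RHS]mulrBr mulr1.
Qed.

Lemma char_diff_ge (c : rat) nu hs chi :
  (forall x : C, x ^+ p = 1 -> (c%:E <= vp (x - 1))%E) ->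
  (((size hs)%:R * c)%:E <= vp (char_diff nu hs chi))%E.
Proof.
move=> c_le; have [n hsE] := char_diffE nu hs.
have [k chik] := factors_at_exists chi.
rewrite (hsE (maxn n k)) ?leq_maxl //; last first.
  exact: factors_at_le (leq_maxr n k) chik.
apply: vp_sum_ge => x _; rewrite !vpM vp_char add0e.
rewrite -[X in (X <= _)%E]add0e leeD ?vp_int_ge0 //.
elim: hs {hsE} => [|h hs IHhs]; first by rewrite big_nil vp1 mul0r.
rewrite big_cons vpM /= -natr1 mulrDl mul1r addrC EFinD leeD //.
exact/c_le/char_root1.
Qed.

Fixpoint subset_products (hs : seq (character C)) : set (character C) :=
  if hs is h :: hs' then
    subset_products hs' `|` char_mul h @` subset_products hs'
  else [set char_one].

Lemma subset_products_finite hs : finite_set (subset_products hs).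
Proof.
elim: hs => [|h hs IHhs] /=; first exact: finite_set1.
by rewrite finite_setU; split => //; exact: finite_image.
Qed.

(** This form needs only the ultrametric inequality at each difference, and no explicit signed sum
    over subfamilies. *)
Lemma char_diff_gt (r : rat) nu hs chi :
  (forall chi0, subset_products hs chi0 ->
     (r%:E < vp (char_eval nu (char_mul chi chi0)))%E) ->
  (r%:E < vp (char_diff nu hs chi))%E.
Proof.
elim: hs chi => [|h hs IHhs] chi /= rM.
  by have := rM char_one erefl; rewrite char_mul1.
apply: vpD_gt; rewrite ?vpN; apply: IHhs => chi0 chi0M; last first.
  by apply: rM; left.
by rewrite -char_mulA; apply: rM; right; exists chi0.
Qed.

(** Here [c] is the valuation of z - 1, which divides every z^i - 1; the values of [nu] are
    Z_p-combinations of powers of z. *)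
Lemma vp_char_eval_discrete : exists c : rat, [/\ 0 < c,
  forall x : C, x ^+ p = 1 -> (c%:E <= vp (x - 1))%E &
  forall nu chi, char_eval nu chi != 0 ->
    exists k : nat, vp (char_eval nu chi) = (k%:R * c)%:E].
Proof.
have [z [zp z1 zgen]] := root1_exists C.
have /vp_fin[c zc] : z - 1 != 0 by rewrite subr_eq0.
exists c; split.
- by rewrite -lte_fin -zc root1_sub1_gt0.
- move=> x /zgen[i ->]; rewrite subrX1 vpM zc leeDl // vp_sum_ge // => j _.
  by rewrite vpX_eq0 // (@vp_root1 _ _ _ p.-1) // prednK ?prime_gt0.
move=> nu chi; have [n chin] := factors_at_exists chi.
rewrite (char_eval_level _ chin).
have /choice[e eP] : forall x, exists i, chi (@extend0 n x) = z ^+ i.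
  by move=> x; apply: zgen; exact: char_root1.
under eq_bigr do rewrite eP.
exact: vp_cyclotomic_integer.
Qed.

End Characters.

Theorem theorem1p6 (p : nat) (p_pr : prime p) (C : complex_padics p_pr)
    (nu : horiz_measure p_pr) (nu_neq0 : exists n : nat, nu n != 0) :
  exists M : set (character C),
    finite_set M /\
    forall chi : character C,
      exists2 chi0 : character C,
        M chi0
        & is_minimum
            [set vp (char_eval nu chi') | chi' in [set: character C]]
            (vp (char_eval nu (char_mul chi chi0))).
Proof.
have [c [c_gt0 root_ge evalE]] := vp_char_eval_discrete C.
(* If all values vanish, their common valuation [+oo] is the minimum. *)
have [all0|] := pselect (forall chi : character C, char_eval nu chi = 0).
  exists [set char_one C]; split => // chi; exists (char_one C) => //.
  split; first by exists (char_mul chi (char_one C)).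
  by move=> _ [chi' _ <-]; rewrite !all0.
move=> /existsNP[chi1 /eqP chi1_neq0].
(* Indexing the valuations by multiples of [c] lets the well-ordering of the naturals provide the
   minimum. *)
pose attained k := `[< exists chi : character C,
  vp (char_eval nu chi) = (k%:R * c)%:E >].
have ex_attained : exists k, attained k.
  have [k chi1k] := evalE nu chi1 chi1_neq0.
  by exists k; apply/asboolP; exists chi1.
have [m /asboolP[chim chimE] m_min] := ex_minnP ex_attained.
have m_le (chi : character C) : ((m%:R * c)%:E <= vp (char_eval nu chi))%E.
  have [->|/evalE[k chik]] := eqVneq (char_eval nu chi) 0.
    by rewrite (vp_eqy (0 : C)).2 ?leey.
  rewrite chik lee_fin ler_pM2r // ler_nat m_min //.
  by apply/asboolP; exists chi.
pose small d := `[< exists hs (chi : character C), size hs = d /\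
  (vp (char_diff nu hs chi) <= (m%:R * c)%:E)%E >].
have ex_small : exists d, small d.
  by exists 0%N; apply/asboolP; exists [::], chim; rewrite /= chimE.
(* A difference of order d has valuation at least d * c, so a maximal small d exists. *)
have small_le d : small d -> (d <= m)%N.
  move=> /asboolP[hs [chi [<- chi_le]]].
  have := le_trans (char_diff_ge nu hs chi root_ge) chi_le.
  by rewrite lee_fin ler_pM2r // ler_nat.
have [d /asboolP[hs [chi2 [size_hs chi2_le]]] d_max] :=
  ex_maxnP ex_small small_le.
have hs_le (chi : character C) : (vp (char_diff nu hs chi) <= (m%:R * c)%:E)%E.
  (* With h = chi / chi2, the differences along [hs] at [chi] and [chi2] differ by one of order d +
     1, which is not small. Were the one at [chi] too large, so would be the one at [chi2]. *)
  have [h chi2h] := char_div_exists chi2 chi.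
  rewrite leNgt; apply/negP => chi_gt.
  have diff_gt : ((m%:R * c)%:E < vp (char_diff nu (h :: hs) chi2))%E.
    rewrite ltNge; apply/negP => diff_le.
    have : small d.+1.
      by apply/asboolP; exists (h :: hs), chi2; rewrite /= size_hs.
    by move=> /d_max; rewrite ltnn.
  move: chi2_le; rewrite leNgt => /negP; apply.
  rewrite -[char_diff nu hs chi2](subKr (char_diff nu hs chi)).
  by apply: vpD_gt; rewrite ?vpN // -[in X in vp (X - _)]chi2h.
exists (subset_products hs).
split=> [|chi]; first exact: subset_products_finite.
have [chi0 chi0M chi0_le] : exists2 chi0, subset_products hs chi0 &
    (vp (char_eval nu (char_mul chi chi0)) <= (m%:R * c)%:E)%E.
  apply: contrapT => no_chi0; have := hs_le chi; rewrite leNgt => /negP; apply.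
  apply: char_diff_gt => chi0 chi0M; rewrite ltNge; apply/negP => chi0_le.
  by apply: no_chi0; exists chi0.
exists chi0 => //; split; first by exists (char_mul chi chi0).
by move=> _ [chi' _ <-]; exact: le_trans (m_le chi').
Qed.
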